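(* Let $P_n$ be the path graph on $[n]$ with edges $(i,i+1)$, $i\in[n-1]$, and let $G$ be a leaf of the reduction tree $R_{P_n}^{\mathcal{O}}$. Let $b(G)=\prod_{a=1}^p\beta_{i_a}$, where $((i_a,j_a),(j_a,k_a))$, $a\in[p]$, are all the reductions on the path from $P_n$ to $G$ in $R_{P_n}^{\mathcal{O}}$ at which one goes to the middle child. Then $$b(G)=\prod_{i=1}^{n-1}\beta_i^{f_G(i)},$$ where $f_G(i)$ is the number of connected components of $G$ (as a graph on $[n]$) such that the shortest edge $e$ of $G$ for which the component lies entirely between the initial and end vertex of $e$ has initial vertex $i$.
   Context: Graphs are finite loopless multigraphs on $[n]$, edges $(i,j)$ with $i<j$ ($i$ initial, $j$ end vertex). Reduction on edges $a=(i,j)$, $b=(j,k)$, $i<j<k$, of a graph $H$ produces $H_1$ ($E(H)\setminus\{b\}\cup\{(i,k)\}$), $H_2$ ($E(H)\setminus\{a\}\cup\{(i,k)\}$), $H_3$ ($E(H)\setminus\{a,b\}\cup\{(i,k)\}$). A reduction tree of $G$ is a rooted tree of graphs with root $G$, each non-leaf node $H$ having three children from one reduction, the left $H_1$, middle $H_3$, right $H_2$; leaves are the graphs with no pair $(i,j),(j,k)$, $i<j<k$. Order $\mathcal{O}$: at a non-leaf node, take the smallest vertex $v$ having edges $(a,v)$, $a<v$, and $(v,b)$, $b>v$, and reduce on such edges with $a$ minimal and $b$ maximal; the resulting tree for the root $P_n$ is $R_{P_n}^{\mathcal{O}}$. $\beta_1,\dots,\beta_{n-1}$ are commuting indeterminates.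 *)

(* Defs.v *)
From HB Require Import structures.
From mathcomp Require Import all_boot all_order all_algebra.
From mathcomp Require Import finmap multiset mpoly zify.

Set Implicit Arguments.
Unset Strict Implicit.
Unset Printing Implicit Defensive.

Import GRing.Theory.

Local Open Scope mset_scope.
Local Open Scope nat_scope.

(* The vertex v of [n] is the ordinal of value v - 1. *)
Definition edge (n : nat) := {e : 'I_n * 'I_n | e.1 < e.2}.

Definition init_v n (e : edge n) : 'I_n := (val e).1.
Definition end_v n (e : edge n) : 'I_n := (val e).2.

Definition edge_len n (e : edge n) : nat := end_v e - init_v e.

Definition multigraph (n : nat) := {mset edge n}.

Lemma path_edge_subproof n (i : 'I_n.-1) :
  (i < n) /\ (i.+1 < n).
Proof. by case: i => i /= hi; lia. Qed.

Definition path_edge n (i : 'I_n.-1) : edge n :=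
  exist (fun e : 'I_n * 'I_n => e.1 < e.2)
        (Ordinal (proj1 (path_edge_subproof i)),
         Ordinal (proj2 (path_edge_subproof i))) (ltnSn i).

Definition path_graph n : multigraph n :=
  seq_mset [seq path_edge i | i <- enum 'I_n.-1].

Definition composable n (a b : edge n) : bool := end_v a == init_v b.

(* The edge (i, k) for a = (i, j) and b = (j, k); the default value a of
   insubd is never used when a and b are composable. *)
Definition comp_edge n (a b : edge n) : edge n :=
  insubd a (init_v a, end_v b).

Definition reduce1 n (H : multigraph n) (a b : edge n) : multigraph n :=
  comp_edge a b +` (H `\ b).
Definition reduce2 n (H : multigraph n) (a b : edge n) : multigraph n :=
  comp_edge a b +` (H `\ a).
Definition reduce3 n (H : multigraph n) (a b : edge n) : multigraph n :=
  comp_edge a b +` ((H `\ a) `\ b).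

Definition reducible_at n (H : multigraph n) (a b : edge n) : bool :=
  [&& a \in H, b \in H & composable a b].

(* A non-leaf node stores its graph, the two edges a and b on which the
   reduction is performed, and its left, middle and right subtrees. *)
Inductive gtree (n : nat) : Type :=
| Leaf of multigraph n
| Node of multigraph n & edge n & edge n & gtree n & gtree n & gtree n.

Definition root_graph n (T : gtree n) : multigraph n :=
  match T with Leaf H => H | Node H _ _ _ _ _ => H end.

Fixpoint is_reduction_tree n (T : gtree n) : Prop :=
  match T with
  | Leaf H => forall a b : edge n, ~~ reducible_at H a b
  | Node H a b l m r =>
      [/\ reducible_at H a b,
          [/\ root_graph l = reduce1 H a b,
              root_graph m = reduce3 H a b &
              root_graph r = reduce2 H a b] &
          [/\ is_reduction_tree l, is_reduction_tree m & is_reduction_tree r]]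
  end.

Definition O_choice n (H : multigraph n) (a b : edge n) : Prop :=
  [/\ reducible_at H a b,
      forall a' b' : edge n, reducible_at H a' b' -> end_v a <= end_v a',
      forall a' : edge n,
        a' \in H -> end_v a' = end_v a -> init_v a <= init_v a' &
      forall b' : edge n,
        b' \in H -> init_v b' = init_v b -> end_v b' <= end_v b].

Fixpoint follows_O n (T : gtree n) : Prop :=
  match T with
  | Leaf _ => True
  | Node H a b l m r =>
      O_choice H a b /\ [/\ follows_O l, follows_O m & follows_O r]
  end.

Definition is_O_reduction_tree n (G : multigraph n) (T : gtree n) : Prop :=
  [/\ root_graph T = G, is_reduction_tree T & follows_O T].

(* leaf_path T G s: some path from the root of T ends at a leaf with graph G,
   and s lists the reductions at which this path goes to the middle child. *)
Inductive leaf_path (n : nat) :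
  gtree n -> multigraph n -> seq (edge n * edge n) -> Prop :=
| leaf_path_leaf G : leaf_path (Leaf G) G [::]
| leaf_path_left H a b l m r G s :
    leaf_path l G s -> leaf_path (Node H a b l m r) G s
| leaf_path_middle H a b l m r G s :
    leaf_path m G s -> leaf_path (Node H a b l m r) G ((a, b) :: s)
| leaf_path_right H a b l m r G s :
    leaf_path r G s -> leaf_path (Node H a b l m r) G s.

Lemma init_index_subproof n (e : edge n) : init_v e < n.-1.
Proof.
rewrite /init_v; case: e => -[[i hi] [j hj]] /= hij; lia.
Qed.

Definition init_index n (e : edge n) : 'I_n.-1 :=
  Ordinal (init_index_subproof e).

(* The indeterminates beta_1, ..., beta_(n-1) are 'X_0, ..., 'X_(n-2). *)
Definition bmon n (s : seq (edge n * edge n)) : {mpoly int[n.-1]} :=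
  (\prod_(r <- s) 'X_(init_index r.1))%R.

Definition adjacent n (G : multigraph n) : rel 'I_n :=
  fun u v => [exists e : edge n, (e \in G) &&
    (((init_v e == u) && (end_v e == v)) ||
     ((init_v e == v) && (end_v e == u)))].

Definition component n (G : multigraph n) (u : 'I_n) : {set 'I_n} :=
  [set v | connect (adjacent G) u v].

Definition components n (G : multigraph n) : {set {set 'I_n}} :=
  [set component G u | u : 'I_n].

(* "Between" is strict; in particular a component of G never lies between the
   two vertices of one of its own edges. *)
Definition lies_between n (e : edge n) (C : {set 'I_n}) : bool :=
  [forall v in C, init_v e < v < end_v e].

Definition shortest_over n (G : multigraph n) (C : {set 'I_n}) (e : edge n) :
  bool :=
  [&& e \in G, lies_between e C &
      [forall e' : edge n, [&& e' \in G, lies_between e' C & e' != e] ==>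
         (edge_len e < edge_len e')]].

Definition fcount n (G : multigraph n) (i : 'I_n.-1) : nat :=
  #|[set C in components G |
      [exists e : edge n, shortest_over G C e && (init_index e == i)]]|.

(* Every multigraph has exactly one reduction tree following O. *)

Lemma comp_edgeE n (a b : edge n) :
  composable a b -> val (comp_edge a b) = (init_v a, end_v b).
Proof.
move=> /eqP h; rewrite /comp_edge insubdK // /in_mem /=.
by apply: (ltn_trans (valP a)); rewrite -/(end_v a) h; apply: (valP b).
Qed.

Definition wt n (e : edge n) := n - edge_len e.
Definition weight n (H : multigraph n) := \sum_(e : edge n) H e * wt e.

Lemma wt_gt0 n (e : edge n) : 0 < wt e.
Proof.
rewrite /wt /edge_len /init_v /end_v; case: e => -[[i hi] [j hj]] /= hij; lia.
Qed.

Lemma weight_add n (H : multigraph n) (c : edge n) :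
  weight (c +` H) = wt c + weight H.
Proof.
rewrite /weight (bigD1 c) //= [in RHS](bigD1 c) //= addnA; congr (_ + _).
  by rewrite mset1DE eqxx mulnDl mul1n.
by apply: eq_bigr => e hec; rewrite mset1DE (negbTE hec).
Qed.

Lemma weight_del n (H : multigraph n) (b : edge n) :
  b \in H -> weight H = wt b + weight (H `\ b).
Proof.
move=> hb; rewrite -weight_add; congr weight.
apply/msetP => e; rewrite mset1DE msetB1E.
by case: eqP => [->|_]; [rewrite subnKC // -in_mset | rewrite subn0].
Qed.

Lemma wt_comp n (a b : edge n) : composable a b ->
  (wt (comp_edge a b) < wt a) && (wt (comp_edge a b) < wt b).
Proof.
move=> h; have := comp_edgeE h; move/eqP: h.
rewrite /wt /edge_len /init_v /end_v.
case: (comp_edge a b) => -[[i hi] [k hk]] /= hik.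
case: a b => -[[i1 hi1] [j1 hj1]] /= h1 [] [[i2 hi2] [j2 hj2]] /= h2.
by move=> [e1] [e2 e3]; lia.
Qed.

Lemma weight_reduce n (H : multigraph n) a b : reducible_at H a b ->
  [/\ weight (reduce1 H a b) < weight H, weight (reduce2 H a b) < weight H &
      weight (reduce3 H a b) < weight H].
Proof.
move=> /and3P[ha hb hab]; have /andP[w1 w2] := wt_comp hab.
have hb' : b \in H `\ a.
  rewrite in_msetB1 hb andbT; apply/implyP => /eqP e.
  by move: (valP a); rewrite /= -/(init_v a) -/(end_v a) (eqP hab) e ltnn.
have ea := weight_del ha; have eb := weight_del hb.
have eab := weight_del hb'.
have e1 : weight (reduce1 H a b) = _ := weight_add _ _.
have e2 : weight (reduce2 H a b) = _ := weight_add _ _.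
have e3 : weight (reduce3 H a b) = _ := weight_add _ _.
split; first by rewrite e1 eb ltn_add2r.
  by rewrite e2 ea ltn_add2r.
by rewrite e3 [X in _ < X]ea [X in _ < _ + X]eab addnA ltn_add2r (leq_trans w1) ?leq_addr.
Qed.

Lemma O_choice_exists n (H : multigraph n) a0 b0 :
  reducible_at H a0 b0 -> exists a b, O_choice H a b.
Proof.
move=> h0; pose P (x : edge n * edge n) := reducible_at H x.1 x.2.
case: (@arg_minnP _ (a0, b0) P (fun x => end_v x.1) h0) => -[a1 b1] /=.
move=> /and3P[/= ha1 hb1 hab1] min1.
pose Q (a : edge n) := (a \in H) && (end_v a == end_v a1).
have Q1 : Q a1 by rewrite /Q ha1 eqxx.
case: (@arg_minnP _ a1 Q (fun a => init_v a) Q1) => a /andP[ha /eqP ea] mina.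
pose R (b : edge n) := (b \in H) && (init_v b == init_v b1).
have R1 : R b1 by rewrite /R hb1 eqxx.
case: (@arg_maxnP _ b1 R (fun b => end_v b) R1) => b /andP[hb /eqP eb] maxb.
exists a, b; split.
- by rewrite /reducible_at ha hb /composable ea eb.
- by move=> a' b' h; rewrite ea; apply: (min1 (a', b')).
- by move=> a' h e; apply: mina; rewrite /Q h e ea eqxx.
- by move=> b' h e; apply: maxb; rewrite /R h e eb eqxx.
Qed.

Lemma O_choice_unique n (H : multigraph n) a b a' b' :
  O_choice H a b -> O_choice H a' b' -> a = a' /\ b = b'.
Proof.
move=> [h hv ha hb] [h' hv' ha' hb'].
have /and3P[Ha Hb /eqP hab] := h; have /and3P[Ha' Hb' /eqP hab'] := h'.
have ev : end_v a = end_v a'.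
  by apply/val_inj/eqP; rewrite eqn_leq (hv _ _ h') (hv' _ _ h).
have ei : init_v b = init_v b' by rewrite -hab -hab'.
have ea : init_v a = init_v a'.
  by apply/val_inj/eqP; rewrite eqn_leq (ha _ Ha' (esym ev)) (ha' _ Ha ev).
have eb : end_v b = end_v b'.
  by apply/val_inj/eqP; rewrite eqn_leq (hb _ Hb' (esym ei)) (hb' _ Hb ei).
by split; apply: val_inj; rewrite [LHS]surjective_pairing [RHS]surjective_pairing;
  congr pair.
Qed.

Lemma O_reduction_tree_exists n (G : multigraph n) :
  exists T : gtree n, is_O_reduction_tree G T.
Proof.
have [k] := ubnP (weight G); elim: k G => // k IH G hk.
case: (boolP [exists x : edge n * edge n, reducible_at G x.1 x.2]).
  move=> /existsP[[a0 b0] /= /O_choice_exists[a [b hO]]].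
  have h : reducible_at G a b by case: hO.
  have [w1 w2 w3] := weight_reduce h.
  have [|l [l1 l2 l3]] := IH (reduce1 G a b); first exact: leq_trans w1 hk.
  have [|r [r1 r2 r3]] := IH (reduce2 G a b); first exact: leq_trans w2 hk.
  have [|m [m1 m2 m3]] := IH (reduce3 G a b); first exact: leq_trans w3 hk.
  by exists (Node G a b l m r).
move=> /existsPn h; exists (Leaf G); split=> //= a b.
exact: (h (a, b)).
Qed.

Lemma O_reduction_tree_unique n (G : multigraph n) (T T' : gtree n) :
  is_O_reduction_tree G T -> is_O_reduction_tree G T' -> T = T'.
Proof.
elim: T G T' => [H|H a b l IHl m IHm r IHr] G [H'|H' a' b' l' m' r'];
  rewrite /is_O_reduction_tree /=.
- by move=> [-> _ _] [-> _ _].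
- by move=> [-> t _] [-> [h _ _] _]; move: (t a' b'); rewrite h.
- by move=> [-> [h _ _] _] [-> t _]; move: (t a b); rewrite h.
move=> [-> [_ [l1 m1 r1] [l2 m2 r2]] [hO [l3 m3 r3]]].
move=> [-> [_ [l1' m1' r1'] [l2' m2' r2']] [hO' [l3' m3' r3']]].
case: (O_choice_unique hO hO') => ea eb; subst a' b'.
congr Node.
- exact: IHl (And3 l1 l2 l3) (And3 l1' l2' l3').
- exact: IHm (And3 m1 m2 m3) (And3 m1' m2' m3').
- exact: IHr (And3 r1 r2 r3) (And3 r1' r2' r3').
Qed.

(* Main.v *)
(* Number the vertices 0, ..., n-1. When order O reaches the vertex v, its only
   outgoing edge is (v, v+1), and the initial vertices of its incoming edges are
   treated in increasing order. A middle step on (i, v), (v, v+1) adds (i, v+1)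
   and makes v the largest vertex of its component, which from then on lies
   strictly to the right of i and is never touched again. Afterwards some edge
   (i, w) with w > v always survives, and noncrossingness makes the one with the
   smallest w the shortest edge over that component. Every other vertex except
   n-1 stays linked to a larger one, and no edge passes over n-1, so
   component |-> largest vertex matches the components lying under some edge
   with the middle steps, respecting the initial vertex i. *)
Require Import Defs.
From mathcomp Require Import all_boot all_order all_algebra.
From mathcomp Require Import finmap multiset mpoly zify.

Set Implicit Arguments.
Unset Strict Implicit.
Unset Printing Implicit Defensive.

Local Open Scope nat_scope.

(** * Edges and the path graph *)

Lemma edge_lt n (e : edge n) : init_v e < end_v e.
Proof. exact: (valP e). Qed.

Lemma edge_eq n (e f : edge n) :
  init_v e = init_v f :> nat -> end_v e = end_v f :> nat -> e = f.
Proof.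
move=> h1 h2; apply: val_inj.
by rewrite [LHS]surjective_pairing [RHS]surjective_pairing; congr pair; apply: val_inj.
Qed.

Lemma init_comp_edge n (a b : edge n) :
  composable a b -> init_v (comp_edge a b) = init_v a.
Proof. by move=> h; rewrite /init_v comp_edgeE. Qed.

Lemma end_comp_edge n (a b : edge n) :
  composable a b -> end_v (comp_edge a b) = end_v b.
Proof. by move=> h; rewrite /end_v comp_edgeE. Qed.

Lemma path_edgeP n (e : edge n) :
  reflect ((init_v e).+1 = end_v e) (e \in path_graph n).
Proof.
rewrite in_mset mset_seqE -has_count has_pred1.
apply: (iffP mapP) => [[i _ ->] //|h].
by exists (init_index e); [rewrite mem_enum | apply: edge_eq; rewrite //= -h].
Qed.

Lemma path_graph_simple n (e : edge n) : path_graph n e <= 1.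
Proof.
rewrite mset_seqE count_uniq_mem ?leq_b1 // map_inj_uniq ?enum_uniq //.
by move=> i j /(congr1 (fun e => nat_of_ord (init_v e))) /= h; apply: val_inj.
Qed.

(** * The invariant carried down the tree *)

(* State of [H] after a middle step on the edge [(i, v)]. [S] contains the
   component of [v]; the whole interval from [i+1] to [v] need not be closed
   under adjacency, as [i] may have kept edges into it. *)
Definition split_at n (H : multigraph n) (i v : 'I_n) : Prop :=
  [/\ exists S : {set 'I_n},
        [/\ v \in S, forall x : 'I_n, x \in S -> i < x <= v &
            forall e, e \in H -> (init_v e \in S) = (end_v e \in S)],
      forall e, e \in H -> ~~ [&& i < init_v e, init_v e <= v & v < end_v e] &
      exists2 e, e \in H & init_v e = i /\ v < end_v e].

(* [u] is not the largest vertex of its component; the second case is that of a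
   vertex [u] all of whose edges come from smaller vertices. *)
Definition linked n (H : multigraph n) (u : 'I_n) : Prop :=
  exists2 f, f \in H & u < end_v f /\
    (init_v f = u \/ exists2 g, g \in H & init_v g = init_v f /\ end_v g = u).

(* [t] lists the middle steps performed so far. *)
Record O_invariant n (H : multigraph n) (t : seq (edge n * edge n)) : Prop := {
  inv_simple : forall e, H e <= 1;
  inv_noncrossing : forall e f, e \in H -> f \in H ->
    ~~ [&& init_v e < init_v f, init_v f < end_v e & end_v e < end_v f];
  inv_path : forall a b f, reducible_at H a b -> f \in H ->
    (end_v a).+1 < end_v f -> (init_v f).+1 = end_v f;
  inv_sorted : forall a b f, reducible_at H a b -> f \in H ->
    end_v f = (end_v a).+1 :> nat -> init_v f < end_v a -> init_v f < init_v a;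
  inv_linked : forall u : 'I_n, u.+1 < n ->
    u \notin [seq end_v r.1 | r <- t] -> linked H u;
  inv_uniq : uniq [seq end_v r.1 | r <- t];
  inv_split : forall r, r \in t -> split_at H (init_v r.1) (end_v r.1) }.

Lemma invariant_path n : O_invariant (path_graph n) [::].
Proof.
split=> //=.
- exact: path_graph_simple.
- by move=> e f /path_edgeP he /path_edgeP hf; lia.
- by move=> a b f _ /path_edgeP.
- by move=> a b f _ /path_edgeP hf; lia.
move=> u hu _; have hu' : u < n.-1 by lia.
by exists (path_edge (Ordinal hu')); [apply/path_edgeP | split=> //; left; apply: val_inj].
Qed.

(** * Multisets with multiplicities at most one *)

Lemma msetB1_le (K : choiceType) (A : {mset K}%mset) a e : (A `\ a)%mset e <= A e.
Proof. by rewrite msetB1E leq_subr. Qed.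

Lemma in_msetB1_simple (K : choiceType) (A : {mset K}%mset) a e :
  (forall x, A x <= 1) -> (e \in (A `\ a)%mset) = (e \in A) && (e != a).
Proof. by move=> hA; rewrite in_msetB1 ltnNge hA implybF andbC. Qed.

Lemma mset1D_simple (K : choiceType) (A B : {mset K}%mset) c e :
  (forall x, A x <= 1) -> c \notin A -> (forall x, B x <= A x) -> (c +` B)%mset e <= 1.
Proof.
move=> hA cA hB; rewrite mset1DE; case: (e =P c) => [->|_] /=; last exact: leq_trans (hB e) _.
by have := hB c; rewrite in_mset -leqNgt leqn0 in cA; rewrite (eqP cA) leqn0 => /eqP->.
Qed.

Ltac natlia :=
  repeat match goal with |- context [nat_of_ord ?x] => generalize (nat_of_ord x) end;
  clear; intros; lia.

(** * One reduction step preserves the invariant; below, v stands for [end_v a] and i for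
    [init_v a] *)

Section Step.

(* [da] and [db] tell which of [a], [b] the step deletes, so that the three
   children are treated at once. *)
Variables (n : nat) (H H' : multigraph n) (a b : edge n).
Variables (da db : bool) (t : seq (edge n * edge n)).

Hypotheses (invH : O_invariant H t) (Oab : O_choice H a b) (dab : da || db).
Hypothesis H'E : H' = (comp_edge a b +`
  (if da then if db then H `\ a `\ b else H `\ a else H `\ b))%mset.

Let c := comp_edge a b.

Let redab : reducible_at H a b. Proof. by case: Oab. Qed.
Let aH : a \in H. Proof. by case/and3P: redab. Qed.
Let bH : b \in H. Proof. by case/and3P: redab. Qed.
Let ab : end_v a = init_v b. Proof. by case/and3P: redab => _ _ /eqP. Qed.
Let c1 : init_v c = init_v a.
Proof. by apply: init_comp_edge; case/and3P: redab. Qed.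
(** By [inv_path], an edge ending beyond v+1 is still a path edge, and a path edge starting at v
    ends at v+1. *)
Let b2 : end_v b = (end_v a).+1 :> nat.
Proof.
have := inv_path invH redab bH; rewrite -ab; have := edge_lt b; rewrite -ab; natlia.
Qed.
Let c2 : end_v c = (end_v a).+1 :> nat.
Proof. by rewrite /c end_comp_edge ?b2 //; case/and3P: redab. Qed.
(** By [inv_sorted], an edge into v+1 from before v starts before every remaining edge into v, in
    particular before i. So no multiple edge ever arises. *)
Let cNH : c \notin H.
Proof.
apply/negP => cH; have := inv_sorted invH redab cH c2.
by rewrite c1 ltnn edge_lt => /(_ isT).
Qed.
Let aNb : a == b = false.
Proof. by apply/eqP => h; have := edge_lt a; rewrite ab -h ltnn. Qed.

Let memH' e :
  (e \in H') = (e == c) || [&& e \in H, ~~ (da && (e == a)) & ~~ (db && (e == b))].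
Proof.
have hs := inv_simple invH.
rewrite H'E in_mset1D -/c; congr (_ || _).
case: da db dab => -[] //= _; rewrite !in_msetB1_simple ?andbT //; last first.
  by move=> x; apply: leq_trans (hs x); apply: msetB1_le.
by rewrite -andbA.
Qed.

Let simple' e : H' e <= 1.
Proof.
rewrite H'E; apply: mset1D_simple (inv_simple invH) cNH _ => x.
case: da db => -[]; rewrite ?msetB1_le //.
by apply: leq_trans (msetB1_le _ _ _) (msetB1_le _ _ _).
Qed.

Let old e : e \in H' -> e = c \/ e \in H.
Proof. by rewrite memH' => /orP[/eqP->|/andP[]]; [left|right]. Qed.

Let cH' : c \in H'. Proof. by rewrite memH' eqxx. Qed.

Let min_end x y : reducible_at H x y -> end_v a <= end_v x.
Proof. by case: Oab => _ h _ _ /h. Qed.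

Let min_init x : x \in H -> end_v x = end_v a :> nat -> init_v a <= init_v x.
Proof. by case: Oab => _ _ h _ hx e; apply: h hx (val_inj e). Qed.

(** [c] ends where [b] does and starts where [a] does; substituting these for [c] shows that no new
    reducible vertex appears. *)
Let red_old x y : reducible_at H' x y ->
  exists x' y', reducible_at H x' y' /\ end_v x' = end_v x.
Proof.
move=> /and3P[hx hy hxy].
exists (if x == c then b else x), (if y == c then a else y).
rewrite /reducible_at /composable (_ : end_v (if _ then _ else _) = end_v x); last first.
  by case: (x =P c) => [->|//]; apply: val_inj; rewrite /= b2 c2.
split=> //; rewrite (_ : init_v (if _ then _ else _) = init_v y); last first.
  by case: (y =P c) => [->|//]; rewrite c1.
rewrite (eqP hxy) eqxx andbT; apply/andP; split.
  by case: (x =P c) (old hx) => [//|xc [/xc|//]].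
by case: (y =P c) (old hy) => [//|yc [/yc|//]].
Qed.

(** An edge crossing [c] on the right ends beyond v+1, so it is a path edge and cannot start inside
    [c]. One crossing on the left either crosses [a] or ends at v, against the minimality of i. *)
Let noncrossing' e f : e \in H' -> f \in H' ->
  ~~ [&& init_v e < init_v f, init_v f < end_v e & end_v e < end_v f].
Proof.
move=> /old[->|he] /old[->|hf]; rewrite ?c1 ?c2.
- natlia.
- by have := inv_path invH redab hf; natlia.
- have := inv_noncrossing invH he aH; have := min_init he; natlia.
- exact: (inv_noncrossing invH he hf).
Qed.

Let path' x y f : reducible_at H' x y -> f \in H' ->
  (end_v x).+1 < end_v f -> (init_v f).+1 = end_v f.
Proof.
move=> /red_old[x' [y' [r <-]]] /old[->|hf].
  by have := min_end r; rewrite c2; natlia.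
exact: (inv_path invH r hf).
Qed.

Let sorted' x y f : reducible_at H' x y -> f \in H' ->
  end_v f = (end_v x).+1 :> nat -> init_v f < end_v x -> init_v f < init_v x.
Proof.
move=> r' hf; have [x' [y' [r e']]] := red_old r'; have := min_end r; rewrite e' => m.
have /and3P[hx hy /eqP hxy] := r'.
case: (old hf) => [->|hf0].
  (* The reduction is again at v, so its outgoing edge is [b]; hence [a] was deleted, and minimality
     of i gives the strict inequality. *)
  rewrite c1 c2 => -[e] hlt.
  have xH : x \in H by case: (old hx) => // xc; move: e; rewrite xc c2; natlia.
  have yb : y = b.
    have yH : y \in H by case: (old hy) => // yc; move: hlt; rewrite hxy yc c1 ltnn.
    have : (end_v a).+1 < end_v y -> (init_v y).+1 = end_v y by exact: (inv_path invH redab yH).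
    have := edge_lt y; move=> h1 h2; apply: edge_eq; rewrite -?ab -?hxy -?e // b2.
    move: h1 h2 e; rewrite -hxy; natlia.
  have dbF : db = false.
    move: hy; rewrite yb memH' eqxx andbT.
    have /negbTE-> : b != c by apply: contraNneq cNH => <-.
    by case: (db); rewrite ?andbF.
  have daT : da by move: dab; rewrite dbF orbF.
  have xa : x != a.
    apply/eqP => xa; move: hx; rewrite xa memH' eqxx daT andbF orbF => /eqP ac.
    by move: cNH; rewrite /= -ac aH.
  have := min_init xH (esym e); rewrite leq_eqVlt => /orP[/eqP h|//].
  by case/eqP: xa; apply: edge_eq.
case: (old hx) => [xc|xH]; last first.
  by apply: (inv_sorted invH (b := if y == c then a else y)) => //;
     rewrite /reducible_at xH /=; case: (old hy) => [yc|yH];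
     [rewrite yc eqxx aH /composable hxy yc c1 /= |
      have /negbTE-> : y != c by [apply: contraNneq cNH => <-];
      rewrite yH /composable hxy /=].
(* Here the reduction is at v+1, and the only edge into v+2 is still the path edge. *)
rewrite xc c2 => e; have := inv_path invH redab hf0; move: e; natlia.
Qed.

(** The latest middle step comes first, so the list collected down to a leaf is the reverse of
    [s]. *)
Definition popped := if da && db then (a, b) :: t else t.

Let linked' (u : 'I_n) : u.+1 < n ->
  u \notin [seq end_v r.1 | r <- popped] -> linked H' u.
Proof.
move=> hu hp; have hpt : u \notin [seq end_v r.1 | r <- t].
  by move: hp; rewrite /popped; case: (da && db) => //=; rewrite inE negb_or => /andP[].
have keep e : e \in H -> e != a -> e != b -> e \in H'.
  by move=> he /negbTE ea /negbTE eb; rewrite memH' he ea eb !andbF orbT.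
have [f hf [uf hfu]] := inv_linked invH hu hpt.
case: hfu => [fu|[g hg [gf gu]]].
  case: (f =P a) => [fa|/eqP fa].
    exists c => //; rewrite c1 c2 -fa; split; [move: uf; natlia | by left].
  case: (f =P b) => [fb|/eqP fb]; last by exists f; [apply: keep | split=> //; left].
  have ua : u = end_v a by rewrite -fu fb ab.
  case dbE : db; last first.
    exists f; [|by split=> //; left].
    by rewrite memH' hf fb dbE (eq_sym b a) aNb andbF orbT.
  (* When only [b] is deleted, [a] and [c] share their initial vertex and link v to v+1. *)
  exists c => //; rewrite c1 c2 ua; split=> //; right; exists a => //.
  have daF : da = false.
    by move: hp; rewrite /popped dbE andbT; case: da => //=; rewrite ua inE eqxx.
  by rewrite memH' aH daF aNb andbF orbT.
(* If [g] were [a], then [f] would be the new edge [c]; if [g] were [b], then [f] would go from v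
   beyond v+1. *)
have hg' : g \in H'.
  apply: keep => //; apply/eqP => hE.
    have fi : init_v f = init_v a by rewrite -gf hE.
    have := inv_path invH redab hf; rewrite -hE gu fi => h.
    have lt := edge_lt a.
    have fE : end_v f = (end_v a).+1 :> nat by move: h uf lt; rewrite -hE gu; natlia.
    by move: cNH; rewrite /= (_ : c = f) ?hf //; apply: edge_eq; rewrite ?c1 ?c2 ?fi ?fE.
  have := inv_path invH redab hf; rewrite -gf hE -ab.
  move: (uf); rewrite -gu hE b2; natlia.
case: (f =P a) => [fa|/eqP fa].
  exists c => //; rewrite c1 c2 -fa; split; [move: uf; natlia | by right; exists g].
case: (f =P b) => [fb|/eqP fb]; last by exists f; [apply: keep | split=> //; right; exists g].
by move: (edge_lt g) uf; rewrite gf gu fb -ab b2; natlia.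
Qed.

(** After a middle step no edge leaves its vertex to the right, whereas [b] leaves v. *)
Let not_popped : end_v a \notin [seq end_v r.1 | r <- t].
Proof.
apply/mapP => -[r hr e]; have [_ h _] := inv_split invH hr.
by have := h b bH; rewrite -ab -e b2; have := edge_lt r.1; rewrite -e; natlia.
Qed.

Let uniq' : uniq [seq end_v r.1 | r <- popped].
Proof. by rewrite /popped; case: (da && db); rewrite /= ?not_popped (inv_uniq invH). Qed.

(** [c] joins the ends of the walk [a], [b], so closed sets stay closed; if the surviving edge was
    [a], then [c] takes over from the same initial vertex. *)
Let split_old (i v : 'I_n) : i < v -> split_at H i v -> split_at H' i v.
Proof.
move=> iv [[S [vS Si SH]] hN [e he [ei ve]]].
have bN := hN b bH; have aN := hN a aH; split.
- exists S; split=> // f /old[->|]; last exact: SH.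
  by rewrite c1 (SH a aH) ab (SH b bH); congr (_ \in S); apply: val_inj; rewrite /= c2 b2.
- move=> f /old[->|]; last exact: hN.
  move: bN aN; rewrite -ab b2 c1 c2; have := edge_lt a; natlia.
case: (e =P a) => [ea|/eqP ea].
  exists c => //; rewrite c1 c2 -ei ea; split=> //; move: ve; rewrite ea; natlia.
case: (e =P b) => [eb|/eqP eb].
  by move: ve iv; rewrite eb b2 ab -eb ei; natlia.
by exists e => //; rewrite memH' he (negbTE ea) (negbTE eb) !andbF orbT.
Qed.

Let split_new : da && db -> split_at H' (init_v a) (end_v a).
Proof.
move=> /andP[daT dbT].
have mem e : e \in H' -> e = c \/ [/\ e \in H, e <> a & e <> b].
  by rewrite memH' daT dbT /= => /orP[/eqP|/and3P[? /eqP ? /eqP ?]]; [left|right].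
have noout e : e \in H' -> init_v e <> end_v a :> nat.
  move=> /mem[->|[eH _ eb]]; first by rewrite c1; have := edge_lt a; natlia.
  move=> h; apply: eb; apply: edge_eq; rewrite -?ab ?b2 //.
  have := inv_path invH redab eH; have := edge_lt e; move: h; natlia.
have noin e : e \in H' -> init_v e <= init_v a -> end_v e <> end_v a :> nat.
  move=> /mem[->|[eH ea _]]; first by rewrite c2; natlia.
  by move=> le h; apply: ea; apply: edge_eq => //; have := min_init eH h; move: le; natlia.
have nored x y : x \in H -> y \in H -> end_v x = init_v y :> nat -> end_v a <= end_v x.
  by move=> hx hy hxy; apply: (@min_end x y); rewrite /reducible_at hx hy /composable; apply/eqP/val_inj.
have crs := inv_noncrossing invH; have lta := edge_lt a.
split; last by exists c => //; rewrite c1 c2.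
  (* [S] is the part of the interval from i+1 to v to the right of all remaining edges from i that
     end by v. *)
  exists [set x : 'I_n | (init_v a < x <= end_v a) &&
     [forall g : edge n, (g \in H') && (init_v g == init_v a) && (end_v g <= end_v a)
        ==> (end_v g < x)]].
  split.
  - rewrite inE lta leqnn /=; apply/forallP => g; apply/implyP => /andP[/andP[gH /eqP gi] le].
    by have := noin g gH; move: le; rewrite gi leqnn => le' /(_ isT); move: le'; natlia.
  - by move=> x; rewrite inE => /andP[].
  move=> e eH'; rewrite !inE; case: (mem e eH') => [->|[eH ea eb]].
    by rewrite c1 c2; natlia.
  have lte := edge_lt e; have n1 := noout e eH'; have n2 := noin e eH'.
  have c3 := crs _ _ aH eH; have c4 := crs _ _ eH aH.
  (* An edge ending in [S] starts after i: from i it would itself bound [S], and from before i it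
     would cross [a] or end at v against the choice of [a]. *)
  have ei : init_v a < end_v e <= end_v a ->
      (e \in H') && (init_v e == init_v a) && (end_v e <= end_v a) ==> (end_v e < end_v e) ->
      init_v a < init_v e.
    rewrite eH' ltnn; case: (init_v e =P init_v a) => [_|E] /=; first natlia.
    have {}E : init_v e <> init_v a :> nat by move/val_inj.
    move: E (min_init eH) c4 n2; natlia.
  apply/andP/andP => -[h /forallP hg]; split.
  + move: h n1 c3 lte; natlia.
  + by apply/forallP => g; apply/implyP => hg'; have := hg g; move: lte; rewrite hg' /=; natlia.
  + by move: lte h (ei h (hg e)); natlia.
  apply/forallP => g; apply/implyP => /andP[/andP[gH' /eqP gi] le].
  have := hg g; rewrite gH' gi eqxx le /= => ge.
  case: (mem g gH') => [gc|[gH ga gb]]; first by move: le; rewrite gc c2; natlia.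
  have := noin g gH'; rewrite gi leqnn => /(_ isT) gv.
  (* If [e] started before the end of [g], the two would cross; if it started there, a reduction
     would be possible before v. *)
  have := nored g e gH eH; have := crs _ _ gH eH; have := ei h (hg e).
  move: ge gv le; rewrite gi; natlia.
move=> e eH'; case: (mem e eH') => [->|[eH ea eb]]; first by rewrite c1; natlia.
have := noout e eH'; have := crs _ _ aH eH; natlia.
Qed.

Lemma invariant_step : O_invariant H' popped.
Proof.
split; [exact: simple' | exact: noncrossing' | exact: path' | exact: sorted' |
  exact: linked' | exact: uniq' |].
have hold r : r \in t -> split_at H' (init_v r.1) (end_v r.1).
  by move=> hr; exact: (split_old (edge_lt _) (inv_split invH hr)).
rewrite /popped; case dE : (da && db) => // r; rewrite inE => /orP[/eqP->|/hold //].
exact: split_new.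
Qed.

End Step.

(** * The invariant at the leaves *)

Lemma invariant_leaf_path n (T : gtree n) G s : leaf_path T G s ->
  forall t, is_reduction_tree T -> follows_O T -> O_invariant (root_graph T) t ->
  O_invariant G (catrev s t).
Proof.
elim=> {T G s} [//|H a b l m r G s _ IH|H a b l m r G s _ IH|H a b l m r G s _ IH] t /=
  [_ [l0 m0 r0] [l1 m1 r1]] [Oab [l2 m2 r2]] inv; apply: IH => //.
- by rewrite l0; exact: (invariant_step (da := false) (db := true) inv Oab isT erefl).
- by rewrite m0; exact: (invariant_step (da := true) (db := true) inv Oab isT erefl).
- by rewrite r0; exact: (invariant_step (da := true) (db := false) inv Oab isT erefl).
Qed.

(** * Components and the edges over them *)

Lemma adjacent_edge n (G : multigraph n) e : e \in G -> adjacent G (init_v e) (end_v e).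
Proof. by move=> he; apply/existsP; exists e; rewrite he !eqxx. Qed.

Lemma adjacent_sym n (G : multigraph n) : ssrbool.symmetric (adjacent G).
Proof. by move=> u v; apply: eq_existsb => e; rewrite orbC. Qed.

Lemma component_sym n (G : multigraph n) : connect_sym (adjacent G).
Proof. exact: sym_connect_sym (@adjacent_sym n G). Qed.

Lemma component_eq n (G : multigraph n) u v :
  v \in component G u -> component G v = component G u.
Proof.
rewrite inE => h; apply/setP => x; rewrite !inE.
by rewrite (same_connect (component_sym G) h).
Qed.

Lemma component_linked n (G : multigraph n) u : linked G u ->
  exists2 v : 'I_n, u < v & v \in component G u.
Proof.
move=> [f fG [uf h]]; exists (end_v f) => //; rewrite inE.
have fa := adjacent_edge fG; case: h => [<-|[g gG [gf <-]]]; first exact: connect1.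
apply: connect_trans (connect1 fa); apply: connect1.
by rewrite -gf adjacent_sym adjacent_edge.
Qed.

Lemma component_split n (G : multigraph n) i v : split_at G i v ->
  forall x : 'I_n, x \in component G v -> i < x <= v.
Proof.
move=> [[S [vS hS cS]] _ _] x; rewrite inE => vx; apply: hS.
rewrite -(closed_connect _ vx) // => y z /existsP[e /andP[/cS he]].
by case/orP=> /andP[/eqP<- /eqP<-].
Qed.

Lemma shortest_over_unique n (G : multigraph n) C e f :
  shortest_over G C e -> shortest_over G C f -> e = f.
Proof.
move=> /and3P[eG eC /forallP he] /and3P[fG fC /forallP hf].
apply/eqP; apply: contraT => ef.
by move: (he f) (hf e); rewrite eG eC fG fC ef eq_sym ef /= => /ltnW; rewrite leqNgt => /negbTE->.
Qed.

(** Among the edges from i passing over v, take the one with the smallest end. Any other edge over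
    the component starts at i or earlier, and is longer by minimality in the first case and by
    noncrossingness in the second. *)
Lemma shortest_over_split n (G : multigraph n) t i v : O_invariant G t -> split_at G i v ->
  exists2 e, shortest_over G (component G v) e & init_v e = i.
Proof.
move=> inv sp; have hC := component_split sp; have [_ hN [e0 e0G [e0i e0v]]] := sp.
have iv : i < v by have := hC v; rewrite inE connect0 => /(_ isT) /andP[].
pose P (e : edge n) := [&& e \in G, init_v e == i & v < end_v e].
have P0 : P e0 by rewrite /P e0G e0i eqxx.
case: (@arg_minnP _ e0 P (fun e => end_v e) P0) => e /and3P[eG /eqP ei ve] emin.
exists e => //; rewrite /shortest_over eG /=; apply/andP; split.
  by apply/forallP => x; apply/implyP => /hC; rewrite ei; move: ve; natlia.
apply/forallP => f; apply/implyP => /and3P[fG /forallP/(_ v)].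
rewrite inE connect0 /= => fv fe.
have := hN f fG; have := inv_noncrossing inv fG eG; have := emin f; rewrite /P fG /=.
rewrite /edge_len ei; case: (init_v f =P i) => [fi|fi] /=.
  have ef : end_v f <> end_v e :> nat.
    by move=> h; case/eqP: fe; apply: edge_eq; rewrite ?fi ?ei.
  by rewrite fi; move: fv ef iv ve; rewrite fi; natlia.
have {}fi : init_v f <> i :> nat by move/val_inj.
by move: fv fi iv ve; natlia.
Qed.

Lemma fcount_count n (G : multigraph n) t i : O_invariant G t ->
  fcount G i = count (fun r => init_index r.1 == i) t.
Proof.
move=> inv.
pose L := [seq component G v | v <- [seq end_v r.1 | r <- t & init_index r.1 == i]].
have memt r : r \in [seq r <- t | init_index r.1 == i] ->
    split_at G (init_v r.1) (end_v r.1).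
  by rewrite mem_filter => /andP[_]; apply: inv_split.
(* A split vertex is the largest of its component, so the component determines it. *)
have uL : uniq L.
  rewrite map_inj_in_uniq.
    by apply: subseq_uniq (inv_uniq inv); apply/map_subseq/filter_subseq.
  move=> _ _ /mapP[r /memt hr ->] /mapP[r' /memt hr' ->] h; apply: val_inj => /=.
  have self u : u \in component G u by rewrite inE connect0.
  have := component_split hr (x := end_v r'.1); rewrite h => /(_ (self _))/andP[_ h1].
  have := component_split hr' (x := end_v r.1); rewrite -h => /(_ (self _))/andP[_ h2].
  by apply/eqP; rewrite eqn_leq h2 h1.
transitivity (size L); last by rewrite !size_map size_filter.
rewrite -(card_uniqP uL); apply: eq_card => C; rewrite inE; apply/andP/idP.
  case=> /imsetP[u _ ->] /existsP[e /andP[he /eqP ei]].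
  have uu : u \in component G u by rewrite inE connect0.
  case: (@arg_maxnP _ u (mem (component G u)) (fun v => v) uu) => m mu mmax.
  (* Since [m] lies strictly below the end of [e], it is not the last vertex, and [inv_linked]
     applies to it. *)
  have /and3P[_ /forallP/(_ m)/implyP/(_ mu)/andP[_ mn] _] := he.
  have mp : m \in [seq end_v r.1 | r <- t].
    apply: contraT => mp.
    have [v mv] := component_linked (inv_linked inv (leq_ltn_trans mn (ltn_ord _)) mp).
    by rewrite (component_eq mu) => /mmax /=; rewrite leqNgt mv.
  case/mapP: mp => r rt mr; rewrite -(component_eq mu) in he *.
  (* Uniqueness of the shortest edge forces the middle step at [m] to have index [i]. *)
  have [f hf fi] := shortest_over_split inv (inv_split inv rt).
  apply: map_f; rewrite mr; apply: map_f; rewrite mem_filter rt andbT -ei.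
  by rewrite -mr in hf; rewrite (shortest_over_unique he hf) -val_eqE /= fi.
case/mapP => _ /mapP[r hr ->] ->; split; first exact: imset_f.
have [f hf fi] := shortest_over_split inv (memt r hr).
apply/existsP; exists f; rewrite hf; move: hr; rewrite mem_filter => /andP[/eqP<- _].
by rewrite -val_eqE /= fi.
Qed.

Local Open Scope ring_scope.

Theorem theorem11 (n : nat) (T : gtree n)
    (hT : is_O_reduction_tree (path_graph n) T)
    (G : multigraph n) (s : seq (edge n * edge n))
    (hG : leaf_path T G s) :
  bmon s = \prod_(i < n.-1) 'X_i ^+ fcount G i.
Proof.
have [rT redT OT] := hT.
have inv : O_invariant G (rev s).
  by apply: (invariant_leaf_path hG) => //; rewrite rT; apply: invariant_path.
rewrite /bmon (partition_big (fun r => init_index r.1) xpredT) //=.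
apply: eq_bigr => i _; rewrite (fcount_count i inv) count_rev.
rewrite (eq_bigr (fun=> 'X_i)) => [|r /eqP-> //].
by rewrite big_const_seq -Monoid.iteropE.
Qed.
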